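(* Let $N\ge 2$ and let $D=(D_{ij})$ be a real $N\times N$ matrix with $D_{ii}=0$ for all $i$ (not necessarily symmetric). For $\sigma\in S_N$ let $L_\sigma(D)=\sum_{i=1}^N D_{\sigma(i),\sigma(i+1)}$ with $\sigma(N+1):=\sigma(1)$, and $L_{min}(D)=\min_{\sigma\in S_N}L_\sigma(D)$. Let $\mathbf 1=(1,\dots,1)^T$, $J=\mathbf 1\mathbf 1^T$, $P_{\mathbf 1^\perp}=I-\frac1NJ$. (i) If $P_{\mathbf 1^\perp}DP_{\mathbf 1^\perp}$ is a normal matrix, then $$L_{min}(D)\ge\sum_{j=1}^{N-1}\mathrm{Re}\Bigl(\bigl(1-e^{2\pi i j/N}\bigr)\varpi_j\Bigr)=\sum_{j=1}^{N-1}\Bigl[\bigl(1-\cos\tfrac{2\pi j}{N}\bigr)\mathrm{Re}(\varpi_j)+\sin\bigl(\tfrac{2\pi j}{N}\bigr)\mathrm{Im}(\varpi_j)\Bigr],$$ where $\varpi_1,\dots,\varpi_{N-1}$ are the (possibly complex) eigenvalues, with multiplicity, of the restriction of $-P_{\mathbf 1^\perp}DP_{\mathbf 1^\perp}$ to $\mathbf 1^\perp$, labeled so as to minimize the sum. (ii) Without any normality assumption, $$L_{min}(D)\ge\sum_{j=1}^{N-1}\bigl(1-\cos\tfrac{2\pi j}{N}\bigr)\mu_j^{H}+\sum_{j=1}^{N-1}\sin\bigl(\tfrac{2\pi j}{N}\bigr)\mu_j^{AH},$$ where $\mu^H_1,\dots,\mu^H_{N-1}$ are the (real) eigenvalues of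 the restriction of $-P_{\mathbf 1^\perp}\frac{D+D^T}{2}P_{\mathbf 1^\perp}$ to $\mathbf 1^\perp$ and $\mu^{AH}_1,\dots,\mu^{AH}_{N-1}$ are the (real) eigenvalues of the restriction of $-P_{\mathbf 1^\perp}\frac{D-D^T}{2i}P_{\mathbf 1^\perp}$ to $\mathbf 1^\perp$, each labeled so as to make the respective sums as small as possible.
   Context: $L_{min}(D)$ is the optimal value of the (asymmetric) traveling salesman problem with distance matrix $D$, where $D_{ij}$ is the distance from city $i$ to city $j$. $S_N$ is the set of permutations of $\{1,\dots,N\}$. *)

(* Defs.v *)
From HB Require Import structures.
From mathcomp Require Import all_boot all_order all_algebra all_fingroup.
From mathcomp Require Import mxred spectral complex.
From mathcomp Require Import reals trigo.

Set Implicit Arguments.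
Unset Strict Implicit.
Unset Printing Implicit Defensive.

Import Order.TTheory GRing.Theory Num.Theory.

Local Open Scope ring_scope.
Local Open Scope complex_scope.

Section Tour.
Variables (R : realType) (N : nat).

Definition tour_length (D : 'M[R]_N) (s : 'S_N) : R :=
  \sum_(i < N) D (s i) (s (ordS i)).

Definition Lmin (D : 'M[R]_N) : R :=
  \big[Num.min/tour_length D 1%g]_(s : 'S_N) tour_length D s.

End Tour.

Section Projection.
Variables (F : fieldType) (N : nat).

Definition ones : 'cV[F]_N := const_mx 1.

Definition Jmx : 'M[F]_N := ones *m ones^T.

Definition Pperp : 'M[F]_N := 1%:M - N%:R^-1 *: Jmx.

(* The compression P A P of A to the orthogonal complement of [ones]. *)
Definition compress (A : 'M[F]_N) : 'M[F]_N := Pperp *m A *m Pperp.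

(* The row space of [kermx ones] is { u | u *m ones = 0 }, i.e. the orthogonal
   complement of the all-ones vector. *)
Definition ones_perp : 'M[F]_N := kermx ones.

(* Matrix, in a basis of [ones_perp], of the restriction to [ones_perp] of
   x |-> A x acting on column vectors. [restrictmx] is about the action
   u |-> u *m A on row vectors, whence the transpose: (A *m x)^T = x^T *m A^T.
   This is the restriction only when A stabilizes [ones_perp]. *)
Definition restrict_perp (A : 'M[F]_N) : 'M[F]_(\rank ones_perp) :=
  restrictmx ones_perp A^T.

(* w 1, ..., w (N - 1) are the eigenvalues, with algebraic multiplicity, of
   the restriction of A to [ones_perp]; other values of w are irrelevant. *)
Definition perp_eigenvalues (A : 'M[F]_N) (w : nat -> F) : Prop :=
  char_poly (restrict_perp A) = \prod_(1 <= j < N) ('X - (w j)%:P).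

End Projection.

Section Bounds.
Variables (R : realType) (N : nat).

Definition toC (D : 'M[R]_N) : 'M[R[i]]_N := map_mx (real_complex R) D.

(* e^{i t} *)
Definition expi (t : R) : R[i] := cos t +i* sin t.

Definition angle (j : nat) : R := 2 * pi * j%:R / N%:R.

(* w lists the eigenvalues in an order that minimizes the objective S. *)
Definition minimizing_labeling (A : 'M[R[i]]_N) (S : (nat -> R[i]) -> R)
    (w : nat -> R[i]) : Prop :=
  perp_eigenvalues A w /\
  (forall w', perp_eigenvalues A w' -> S w <= S w').

Definition normal_sum (w : nat -> R[i]) : R :=
  \sum_(1 <= j < N) complex.Re ((1 - expi (angle j)) * w j).

Definition cos_sum (w : nat -> R[i]) : R :=
  \sum_(1 <= j < N) (1 - cos (angle j)) * complex.Re (w j).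

Definition sin_sum (w : nat -> R[i]) : R :=
  \sum_(1 <= j < N) sin (angle j) * complex.Re (w j).

End Bounds.

Section Existence.
Variables (R : realType) (N : nat).

Lemma rank_ones_perp (F : numFieldType) : (0 < N)%N ->
  \rank (ones_perp F N) = N.-1.
Proof.
move=> N0; rewrite /ones_perp mxrank_ker -subn1; congr (_ - _)%N.
apply/eqP; rewrite eqn_leq rank_leq_col lt0n mxrank_eq0.
apply/eqP=> /matrixP/(_ (Ordinal N0) 0); rewrite !mxE => /eqP.
by rewrite oner_eq0.
Qed.

(* Minimizing labelings exist for every objective that only reads the values
   w 1, ..., w (N - 1), in particular for the three sums above. *)
Lemma minimizing_labeling_exists (A : 'M[R[i]]_N) (S : (nat -> R[i]) -> R) :
    (0 < N)%N ->
    (forall w w', (forall j, (1 <= j < N)%N -> w j = w' j) -> S w = S w') ->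
  exists w, minimizing_labeling A S w.
Proof.
move=> N0 S_ext; pose p := char_poly (restrict_perp A).
have [r pE] := closed_field_poly_normal p.
rewrite (monicP (char_poly_monic _)) scale1r in pE.
have size_r : size r = N.-1.
  have := size_char_poly (restrict_perp A).
  by rewrite -/p pE size_prod_XsubC rank_ones_perp // => -[].
pose lab (s : seq R[i]) j := nth 0 s j.-1.
pose tab (w : nat -> R[i]) := [seq w j | j <- index_iota 1 N].
have prodE w : \prod_(1 <= j < N) ('X - (w j)%:P)
    = \prod_(z <- tab w) ('X - z%:P) by rewrite big_map.
have tab_lab s : size s = N.-1 -> tab (lab s) = s.
  move=> sz; apply: (@eq_from_nth _ 0).
    by rewrite size_map size_iota subn1.
  move=> i; rewrite size_map size_iota => ltiN.
  by rewrite (nth_map 0%N) ?size_iota // nth_iota.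
have lab_tab w j : (1 <= j < N)%N -> lab (tab w) j = w j.
  case/andP=> j0 jN; have ltj : (j.-1 < N - 1)%N.
    by rewrite -subn1 ltn_sub2r // (leq_ltn_trans j0).
  by rewrite /lab (nth_map 0%N) ?size_iota // nth_iota // add1n prednK.
have r_in : r \in permutations r by rewrite mem_permutations.
pose T := seq_sub (permutations r).
pose m := [arg min_(t < SeqSub r_in : T) S (lab (ssval t))]%O.
have lab_ok (s : seq R[i]) : perm_eq s r -> perp_eigenvalues A (lab s).
  move=> s_r; rewrite /perp_eigenvalues -/p pE prodE tab_lab.
    by apply/perm_big; rewrite perm_sym.
  by rewrite (perm_size s_r).
exists (lab (ssval m)); split.
  by apply: lab_ok; rewrite -mem_permutations (ssvalP m).
move=> w' w'A.
have w'r : perm_eq (tab w') r.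
  by apply: prod_XsubC_eq; rewrite -prodE -w'A -pE.
have w'_in : tab w' \in permutations r by rewrite mem_permutations.
rewrite (S_ext w' (lab (tab w'))); last by move=> j jN; rewrite lab_tab.
rewrite /m; case: arg_minP => //= t _ /(_ (SeqSub w'_in : T)); exact.
Qed.

End Existence.

Arguments compress {F N} A.
Arguments normal_sum {R} N w.
Arguments cos_sum {R} N w.
Arguments sin_sum {R} N w.

(* Main.v *)
(* With respect to the Fourier basis of the cyclic shift along a tour s, the
   length of s is Re sum_j (1 - z^j) Y_jj, where z = e^(2 pi i / N) and Y is the
   matrix of the restriction of - P D P to the orthogonal complement of the
   all-ones vector.  Diagonalizing the normal matrix Y as U^* diag(d) U turns
   this into sum_(j, k) |U_kj|^2 Re((1 - z^j) d_k), a linear functional of a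
   doubly stochastic matrix, hence at least its value at some permutation
   matrix (Birkhoff).  For (ii), split D = H + i K with H and K Hermitian and
   bound both parts separately, with multipliers 1 - z^j and i (1 - z^j). *)
Require Import Defs.
From HB Require Import structures.
From mathcomp Require Import all_boot all_order all_algebra all_fingroup.
From mathcomp Require Import ring lra zify.
From mathcomp Require Import mxred spectral complex.
From mathcomp Require Import reals trigo.

Set Implicit Arguments.
Unset Strict Implicit.
Unset Printing Implicit Defensive.

Import Order.TTheory GRing.Theory Num.Theory.
Local Open Scope ring_scope.
Local Open Scope sesquilinear_scope.

Local Notation conjC := Num.conj.

(** * Linear functionals of doubly stochastic matrices *)

Section Assignment.
Variables (R : realFieldType) (n : nat).
Implicit Types (S T F : 'M[R]_n) (i j : 'I_n).

Definition doubly_stochastic S :=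
  [/\ forall i j, 0 <= S i j, forall i, \sum_j S i j = 1
    & forall j, \sum_i S i j = 1].

(** The descent shrinks this set; once it is empty, a doubly stochastic matrix is a permutation
    matrix. *)
Definition fractional S := [set p | 0 < S p.1 p.2 < 1].

(** The remaining mass [1 - f i] is positive, so some other entry is positive, and that entry is at
    most [1 - f i < 1]. *)
Lemma fractional_entry_twin (f : 'I_n -> R) i :
    (forall j, 0 <= f j) -> \sum_j f j = 1 -> 0 < f i < 1 ->
  exists2 j, j != i & 0 < f j < 1.
Proof.
move=> f0 f1 /andP[fi0 fi1].
have sum_others : \sum_(j | j != i) f j = 1 - f i.
  by rewrite -f1 [in RHS](bigD1 i) //= addrC addrK.
have [j ji fj0] : exists2 j, j != i & 0 < f j.
  have [||j /andP[ji fj]] := @psumr_neq0P R _ (predC1 i) f.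
  - by move=> j _; apply: f0.
  - by rewrite sum_others => /eqP; rewrite subr_eq0 gt_eqF.
  - by exists j.
exists j => //; rewrite fj0 /=; apply: le_lt_trans (_ : 1 - f i < 1).
  by rewrite -sum_others (bigD1 j) //= lerDl sumr_ge0.
by rewrite ltrBlDr ltrDl.
Qed.

(** Each fibre over the image has at least two elements. With [f] a coordinate projection, this
    bounds the number of rows or columns that [E] meets. *)
Lemma card_imset_twin (I J : finType) (f : I -> J) (E : {set I}) :
    (forall p, p \in E -> exists q, [/\ q \in E, q != p & f q = f p]) ->
  (2 * #|f @: E| <= #|E|)%N.
Proof.
move=> twin; rewrite -[leqRHS]sum1_card (partition_big f [in f @: E]) /=.
  rewrite mulnC -sum_nat_const; apply: leq_sum => _ /imsetP[p pE ->].
  have [q [qE qp fqp]] := twin p pE.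
  rewrite (bigD1 p) ?pE ?eqxx //= (bigD1 q) ?qE ?fqp ?eqxx //=.
by move=> p pE; apply: imset_f.
Qed.

Lemma ltn_card_lines (E : {set 'I_n * 'I_n}) (p : 'I_n * 'I_n) : p \in E ->
    (2 * #|fst @: E| <= #|E|)%N -> (2 * #|snd @: E| <= #|E|)%N ->
  (#|fst @: E| + #|(snd @: E) :\ p.2| < #|E|)%N.
Proof.
move=> pE lines1 lines2; have := cardsD1 p.2 (snd @: E).
rewrite imset_f // => cardB.
by rewrite -(ltn_pmul2l (isT : 0 < 2)%N) mulnDr; move: lines1 lines2; rewrite cardB; lia.
Qed.

(** The linear system with one unknown per cell of [E] and one equation per row or column met by
    [E], the column of [p] excepted, has more unknowns than equations. *)
Lemma circulation_exists (E : {set 'I_n * 'I_n}) p : p \in E ->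
    (2 * #|fst @: E| <= #|E|)%N -> (2 * #|snd @: E| <= #|E|)%N ->
  exists T, [/\ T != 0, forall i j, T i j != 0 -> (i, j) \in E,
    forall i, \sum_j T i j = 0 & forall j, \sum_i T i j = 0].
Proof.
move=> pE lines1 lines2; have := @ltn_card_lines E p pE lines1 lines2.
set A := fst @: E; set B := _ :\ _ => ltAB.
(* [G] is the incidence matrix of cells and lines; a vector in its left kernel weights the cells of
   [E] with zero sum on every line kept. *)
pose G : 'M[R]_(#|E|, #|A| + #|B|) := row_mx
  (\matrix_(e, a) ((enum_val e).1 == enum_val a)%:R)
  (\matrix_(e, b) ((enum_val e).2 == enum_val b)%:R).
have /rowV0Pn[u /sub_kermxP uG u0] : kermx G != 0.
  rewrite kermx_eq0 /row_free; apply: contraTneq ltAB => <-.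
  by rewrite -leqNgt rank_leq_col.
move: uG; rewrite mul_mx_row -row_mx0 => /eq_row_mx[uG1 uG2].
pose T : 'M[R]_n := \matrix_(i, j) \sum_e u 0 e * (enum_val e == (i, j))%:R.
have rowT i : \sum_j T i j = \sum_e u 0 e * ((enum_val e).1 == i)%:R.
  under eq_bigr do rewrite mxE.
  rewrite exchange_big; apply: eq_bigr => e _; rewrite -big_distrr /=.
  congr (_ * _); case: (enum_val e) => a b /=.
  under eq_bigr do rewrite xpair_eqE eq_sym [b == _]eq_sym.
  rewrite (bigD1 b) //= eqxx andbT big1 ?addr0 1?eq_sym // => j /negPf->.
  by rewrite andbF.
have colT j : \sum_i T i j = \sum_e u 0 e * ((enum_val e).2 == j)%:R.
  under eq_bigr do rewrite mxE.
  rewrite exchange_big; apply: eq_bigr => e _; rewrite -big_distrr /=.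
  congr (_ * _); case: (enum_val e) => a b /=.
  under eq_bigr do rewrite xpair_eqE eq_sym [b == _]eq_sym.
  rewrite (bigD1 a) //= eqxx big1 ?addr0 1?eq_sym // => i.
  by rewrite eq_sym => /negPf->.
have rowT0 i : \sum_j T i j = 0.
  rewrite rowT; have [iA|iA] := boolP (i \in A).
    move/matrixP/(_ 0 (enum_rank_in iA i)): uG1; rewrite !mxE => uG1.
    by rewrite -[RHS]uG1; apply: eq_bigr => e _; rewrite !mxE enum_rankK_in.
  apply: big1 => e _; case: eqP => [ei|]; last by rewrite mulr0.
  by rewrite -ei imset_f ?enum_valP in iA.
have colT0' j : j != p.2 -> \sum_i T i j = 0.
  move=> jp; rewrite colT; have [jB|jB] := boolP (j \in B).
    move/matrixP/(_ 0 (enum_rank_in jB j)): uG2; rewrite !mxE => uG2.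
    by rewrite -[RHS]uG2; apply: eq_bigr => e _; rewrite !mxE enum_rankK_in.
  apply: big1 => e _; case: eqP => [ej|]; last by rewrite mulr0.
  by rewrite !inE jp -ej imset_f ?enum_valP in jB.
exists T; split => //.
- have [e ue0] : exists e, u 0 e != 0.
    apply/existsP; apply: contraNT u0 => /existsPn u0.
    by apply/eqP/rowP => e; rewrite mxE; apply/eqP; have := u0 e; rewrite negbK.
  apply: contraNneq ue0 => /matrixP/(_ (enum_val e).1 (enum_val e).2).
  rewrite !mxE -surjective_pairing (bigD1 e) //= eqxx mulr1 big1 ?addr0 => [->//|].
  by move=> e' e'e; rewrite (inj_eq enum_val_inj) (negPf e'e) mulr0.
- move=> i j; rewrite mxE; apply: contraNT => ijE; rewrite big1 // => e _.
  by case: eqP => [eij|]; rewrite ?mulr0 //; rewrite -eij enum_valP in ijE.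
(* The excluded column also sums to zero, because all row sums, hence the total, vanish. *)
- move=> j; have [->|/colT0'//] := eqVneq j p.2.
  have : \sum_j \sum_i T i j = 0.
    by rewrite exchange_big big1 // => i _; apply: rowT0.
  by rewrite (bigD1 p.2) //= [X in _ + X]big1 ?addr0.
Qed.

(* At least twice as many fractional entries as lines in each direction leave
   room for a nonzero matrix supported there with zero line sums; moving along
   it in the cheaper direction until an entry vanishes keeps S doubly
   stochastic. *)
Lemma descent S F :
    doubly_stochastic S -> fractional S != set0 ->
  exists S', [/\ doubly_stochastic S', fractional S' \proper fractional S
    & \sum_i \sum_j S' i j * F i j <= \sum_i \sum_j S i j * F i j].
Proof.
move=> [S0 S_row S_col] /set0Pn[p pS].
have [||T [T0 T_supp T_row T_col]] := circulation_exists pS.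
- apply: card_imset_twin => -[i j]; rewrite inE /= => ij.
  have [k kj ik] := fractional_entry_twin (S0 i) (S_row i) ij.
  by exists (i, k); rewrite inE xpair_eqE eqxx.
- apply: card_imset_twin => -[i j]; rewrite inE /= => ij.
  have [k ki kj] := fractional_entry_twin (S0^~ j) (S_col j) ij.
  by exists (k, j); rewrite inE xpair_eqE eqxx andbT.
(* The conditions on [T] are invariant under negation, so its sign can be chosen to make the cost
   nonpositive. *)
wlog costT : T T0 T_supp T_row T_col / \sum_i \sum_j T i j * F i j <= 0.
  move=> IH; have [|/ltW costT] := leP (\sum_i \sum_j T i j * F i j) 0.
    exact: IH.
  apply: (IH (- T)).
  - by rewrite oppr_eq0.
  - by move=> i j; rewrite mxE oppr_eq0; apply: T_supp.
  - by move=> i; under eq_bigr do rewrite mxE; rewrite sumrN T_row oppr0.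
  - by move=> j; under eq_bigr do rewrite mxE; rewrite sumrN T_col oppr0.
  - under eq_bigr do under eq_bigr do rewrite mxE mulNr.
    by under eq_bigr do rewrite sumrN; rewrite sumrN oppr_le0.
have [q0 q0T] : exists q, T q.1 q.2 < 0.
  apply/existsP; apply: contraNT T0 => /existsPn T0.
  have Tge0 i j : true -> 0 <= T i j by move=> _; rewrite leNgt (T0 (i, j)).
  apply/eqP/matrixP => i j; rewrite mxE.
  exact: (psumr_eq0P (Tge0 i) (T_row i)).
(* Ratio test: [t] is an entry that vanishes first along [S + c *: T], and its ratio is the largest
   [c] keeping all entries nonnegative. *)
pose t := [arg min_(q < q0 | T q.1 q.2 < 0) (S q.1 q.2 / - T q.1 q.2)]%O.
have [tT tmin] : T t.1 t.2 < 0 /\ forall q, T q.1 q.2 < 0 ->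
    S t.1 t.2 / - T t.1 t.2 <= S q.1 q.2 / - T q.1 q.2.
  by rewrite /t; case: arg_minP => // q qT min_q; split => // r; apply: min_q.
have tS : t \in fractional S by rewrite [t]surjective_pairing T_supp ?lt_eqF.
set c := _ / _ in tmin.
have c0 : 0 < c.
  by move: tS; rewrite inE => /andP[St _]; rewrite divr_gt0 ?oppr_gt0.
have cT i j : 0 <= (S + c *: T) i j.
  rewrite !mxE; have [Tij|Tij] := leP 0 (T i j).
    by rewrite addr_ge0 // mulr_ge0 // ltW.
  have := tmin (i, j) Tij; rewrite /= ler_pdivlMr ?oppr_gt0 //.
  by rewrite mulrN -subr_ge0 opprK.
have row_sum i : \sum_j (S + c *: T) i j = 1.
  under eq_bigr do rewrite !mxE.
  by rewrite big_split /= -big_distrr /= T_row mulr0 addr0.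
have col_sum j : \sum_i (S + c *: T) i j = 1.
  under eq_bigr do rewrite !mxE.
  by rewrite big_split /= -big_distrr /= T_col mulr0 addr0.
exists (S + c *: T); split => //.
- apply/properP; split.
    apply/subsetP => -[i j]; rewrite 2!inE /= !mxE => Sij.
    have [Tij|/T_supp] := eqVneq (T i j) 0; last by rewrite inE.
    by rewrite Tij mulr0 addr0 in Sij.
  exists t => //; rewrite inE !mxE /c invrN mulrN mulNr divfK ?lt_eqF //.
  by rewrite subrr ltxx.
- under eq_bigr do under eq_bigr do rewrite !mxE mulrDl -mulrA.
  under eq_bigr do rewrite big_split /= -big_distrr /=.
  by rewrite big_split /= -big_distrr /= gerDl mulr_ge0_le0 // ltW.
Qed.

(** A nonzero entry that is not fractional equals 1. Unit row sums then select one column per row,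
    and unit column sums make this choice injective. *)
Lemma integral_assignment S F :
    doubly_stochastic S -> fractional S = set0 ->
  exists s : 'S_n, \sum_i F i (s i) = \sum_i \sum_j S i j * F i j.
Proof.
move=> [S0 S_row S_col] fracS.
have S01 i j : S i j != 0 -> S i j = 1.
  move=> Sij; apply/eqP; rewrite eq_le -[X in _ <= X](S_row i).
  rewrite [X in _ <= X](bigD1 j) //= lerDl sumr_ge0 //=.
  have /setP/(_ (i, j)) := fracS; rewrite !inE /= lt_def Sij S0 /= => /negbT.
  by rewrite -leNgt.
have [f f_supp] : exists f : 'I_n -> 'I_n, forall i, S i (f i) = 1.
  apply: (@fin_all_exists _ _ (fun i j => S i j = 1)) => i.
  have [|j /andP[_ Sij]] := @psumr_neq0P R _ predT (S i) (fun j _ => S0 i j).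
    by rewrite S_row => /eqP; rewrite oner_eq0.
  by exists j; rewrite S01 ?gt_eqF.
have f_inj : injective f.
  move=> i k fik; apply/eqP; apply: contraTT isT => ik.
  have := S_col (f i); rewrite (bigD1 i) //= f_supp (bigD1 k) 1?eq_sym //=.
  rewrite fik f_supp => /eqP; rewrite -subr_eq0 addrAC subrr add0r.
  by rewrite gt_eqF // ltr_wpDr ?ltr01 ?sumr_ge0.
exists (perm f_inj); apply: eq_bigr => i _; rewrite permE.
rewrite (bigD1 (f i)) //= f_supp mul1r big1 ?addr0 // => j jfi.
apply/eqP; rewrite mulf_eq0; apply/orP; left.
have : \sum_(k | k != f i) S i k = 0.
  by apply: (addrI 1); rewrite addr0 -[RHS](S_row i) [RHS](bigD1 (f i)) //= f_supp.
by move/(psumr_eq0P (fun k _ => S0 i k))/(_ j jfi) => ->.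
Qed.

Lemma assignment S F : doubly_stochastic S ->
  exists s : 'S_n, \sum_i F i (s i) <= \sum_i \sum_j S i j * F i j.
Proof.
have [m] := ubnP #|fractional S|; elim: m S => // m IHm S leSm dsS.
have [frac0|/(descent F dsS)[S' [dsS' ltS' cost]]] := eqVneq (fractional S) set0.
  by have [s sE] := integral_assignment F dsS frac0; exists s; rewrite sE.
have [|s les] := IHm S' _ dsS'.
  by apply: leq_trans (proper_card ltS') _; rewrite -ltnS.
by exists s; apply: le_trans les cost.
Qed.

End Assignment.

(** * Characteristic polynomials and change of basis *)

Section CharPoly.
Variable F : fieldType.

Lemma char_poly_similar n (P A B : 'M[F]_n) :
  P \in unitmx -> A *m P = P *m B -> char_poly A = char_poly B.
Proof.
move=> Pu AP; have detP : \det (map_mx polyC P) != 0.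
  by rewrite det_map_mx polyC_eq0 -unitfE -unitmxE.
apply: (mulIf detP); rewrite [RHS]mulrC -!det_mulmx; congr (\det _).
rewrite /char_poly_mx mulmxBl mulmxBr -!map_mxM AP.
by rewrite scalar_mxC.
Qed.

(** [V1] and [V2] are bases of one stable subspace, and the change of basis [P] intertwines the two
    matrices. The row counts [m1] and [m2] are only provably equal: one will be a rank, the other a
    literal dimension. *)
Lemma char_poly_conjmx_eqmx m1 m2 n (V1 : 'M[F]_(m1, n)) (V2 : 'M_(m2, n)) f :
    row_free V1 -> row_free V2 -> (V1 :=: V2)%MS -> stablemx V2 f ->
  char_poly (conjmx V1 f) = char_poly (conjmx V2 f).
Proof.
move=> V1free V2free V12 V2f.
have V1f : stablemx V1 f by rewrite V12 (submx_trans _ V2f) // submxMr ?V12.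
have m12 : m1 = m2 by rewrite -(eqP V1free) -(eqP V2free) V12.
case: m2 / m12 V2 V2free V12 V2f => V2 V2free V12 V2f.
pose P := V1 *m pinvmx V2; pose Q := V2 *m pinvmx V1.
have PV : P *m V2 = V1 by rewrite mulmxKpV ?V12.
have QV : Q *m V1 = V2 by rewrite mulmxKpV ?V12.
have conj1 : conjmx V1 f *m V1 = V1 *m f by rewrite mulmxKpV.
have conj2 : conjmx V2 f *m V2 = V2 *m f by rewrite mulmxKpV.
apply: (@char_poly_similar _ P).
  suff PQ : P *m Q = 1%:M by case/mulmx1_unit: PQ.
  by apply: (row_free_inj V1free); rewrite /= -(mulmxA P) QV PV mul1mx.
apply: (row_free_inj V2free) => /=.
by rewrite -(mulmxA _ P) PV conj1 -(mulmxA P) conj2 mulmxA PV.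
Qed.

End CharPoly.

(** * The projection onto the complement of the all-ones vector *)

Section Compression.
Variables (F : numFieldType) (n : nat).
Local Notation N := n.+1.
Implicit Types A B : 'M[F]_N.

Let N0 : N%:R != 0 :> F. Proof. by rewrite pnatr_eq0. Qed.

Lemma tr_ones_mul_ones : (ones F N)^T *m ones F N = N%:R%:M.
Proof.
apply/matrixP => i j; rewrite !ord1 !mxE.
under eq_bigr do rewrite !mxE mulr1.
by rewrite sumr_const card_ord.
Qed.

Lemma Pperp_ones : Pperp F N *m ones F N = 0.
Proof.
rewrite mulmxBl mul1mx -scalemxAl -mulmxA tr_ones_mul_ones.
by rewrite mul_mx_scalar scalerA mulVf // scale1r subrr.
Qed.

Lemma tr_Pperp : (Pperp F N)^T = Pperp F N.
Proof. by rewrite linearB /= trmx1 linearZ /= trmx_mul trmxK. Qed.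

Lemma Pperp_idem : Pperp F N *m Pperp F N = Pperp F N.
Proof.
by rewrite {2}/Pperp mulmxBr mulmx1 -scalemxAr mulmxA Pperp_ones mul0mx scaler0 subr0.
Qed.

Lemma mul_Pperp_id m (u : 'M[F]_(m, N)) : u *m ones F N = 0 -> u *m Pperp F N = u.
Proof.
by move=> u1; rewrite mulmxBr mulmx1 -scalemxAr mulmxA u1 mul0mx scaler0 subr0.
Qed.

Lemma Pperp_compress A : Pperp F N *m compress A = compress A.
Proof. by rewrite /compress !mulmxA Pperp_idem. Qed.

Lemma compress_Pperp A : compress A *m Pperp F N = compress A.
Proof. by rewrite /compress -!mulmxA Pperp_idem. Qed.

Lemma tr_compress A : (compress A)^T = compress A^T.
Proof. by rewrite /compress !trmx_mul tr_Pperp mulmxA. Qed.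

Lemma compressN A : - compress A = compress (- A).
Proof. by rewrite /compress mulmxN mulNmx. Qed.

(** Compression changes [A] only by a term depending on the row and a term depending on the column;
    such terms cancel around a closed tour. *)
Lemma compress_entry A :
  exists f g : 'I_N -> F, forall a b, compress A a b = A a b - f a - g b.
Proof.
pose A' := Pperp F N *m A.
exists (fun a => (N%:R^-1 *: (A' *m ones F N)) a 0).
exists (fun b => (N%:R^-1 *: ((ones F N)^T *m A)) 0 b) => a b.
have -> : compress A = A - (N%:R^-1 *: (A' *m ones F N)) *m (ones F N)^T
                      - ones F N *m (N%:R^-1 *: ((ones F N)^T *m A)).
  rewrite /compress -/A' {1}/Pperp mulmxBr mulmx1 -scalemxAr mulmxA.
  rewrite {1}/A' mulmxBl mul1mx -!scalemxAl -!scalemxAr /Jmx -mulmxA.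
  by rewrite addrAC -!mulmxA.
rewrite !mxE big_ord_recl big_ord0 addr0 [X in _ - _ - X]big_ord_recl.
by rewrite big_ord0 addr0 !mxE mulr1 mul1r.
Qed.

End Compression.

(** * Stability of normal and Hermitian matrices *)

Section ConjugateTranspose.
Variable C : numClosedFieldType.

Lemma trCmx_conj m p (V : 'M[C]_(m, p)) (f : 'M_p) :
  (V *m f *m V^t*)^t* = V *m f^t* *m V^t*.
Proof. by rewrite !trmx_mul !map_mxM /= trmxCK mulmxA. Qed.

Lemma trmx_normal p (f : 'M[C]_p) : f \is normalmx -> f^T \is normalmx.
Proof.
move=> /normalmxP nf; apply/normalmxP; apply: trmx_inj.
by rewrite !trmxK !trmx_mul trmxK map_trmx nf.
Qed.

Lemma normalmxN p (f : 'M[C]_p) : f \is normalmx -> - f \is normalmx.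
Proof.
move=> /normalmxP nf; have E : (- f)^t* = - (f^t*).
  by apply/matrixP => i j; rewrite !mxE rmorphN.
by apply/normalmxP; rewrite E !mulmxN !mulNmx nf.
Qed.

Lemma map_Pperp n : map_mx conjC (Pperp C n) = Pperp C n.
Proof.
rewrite /Pperp map_mxB map_mx1 map_mxZ fmorphV rmorph_nat.
by rewrite /Jmx map_mxM -map_trmx /ones map_const_mx /= conjC1.
Qed.

Lemma compress_hermitian n (B : 'M[C]_n.+1) : B \is hermsymmx -> compress B \is hermsymmx.
Proof.
move=> /is_hermitianmxP; rewrite expr0 scale1r => hB.
apply/is_hermitianmxP; rewrite expr0 scale1r tr_compress.
by rewrite /compress !map_mxM map_Pperp -hB.
Qed.

Lemma hermsymmxN n (B : 'M[C]_n) : B \is hermsymmx -> - B \is hermsymmx.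
Proof.
move=> /is_hermitianmxP; rewrite expr0 scale1r => hB.
apply/is_hermitianmxP; rewrite expr0 scale1r {1}hB.
by apply/matrixP => i j; rewrite !mxE rmorphN.
Qed.

Lemma trCmxE m p (A : 'M[C]_(m, p)) i j : A^t* i j = (A j i)^*.
Proof. by rewrite !mxE. Qed.

End ConjugateTranspose.

(** * The Fourier basis along a tour *)

Section Fourier.
Variables (C : numClosedFieldType) (n : nat) (z : C) (s : 'S_n.+1).
Local Notation N := n.+1.
Hypothesis z_prim : N.-primitive_root z.

Lemma conj_prim_root : z^* = z^-1.
Proof.
have zN : `|z| ^+ N == 1 by rewrite -normrX (prim_expr_order z_prim) normr1.
by rewrite invC_norm (eqP (_ : `|z| == 1)) ?expr1n ?invr1 ?mul1r // -(@pexpr_eq1 _ _ N).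
Qed.

(** Geometric sum: [u = z ^+ a / z ^+ b] satisfies [u ^+ N = 1], so the sum vanishes unless
    [u = 1]. *)
Lemma sum_prim_root (a b : nat) :
  \sum_(i < N) (z ^+ a / z ^+ b) ^+ i = N%:R * (a == b %[mod N])%:R.
Proof.
have z0 : z ^+ b != 0.
  apply: expf_neq0; apply: contra_eq_neq (prim_expr_order z_prim) => ->.
  by rewrite expr0n eq_sym oner_eq0.
rewrite -(eq_prim_root_expr z_prim); set u := _ / _.
have -> : (z ^+ a == z ^+ b) = (u == 1).
  by rewrite -[RHS](inj_eq (mulIf z0)) divfK // mul1r.
have [->|u1] := eqVneq u 1.
  by under eq_bigr do rewrite expr1n; rewrite sumr_const card_ord mulr1.
rewrite mulr0; apply/eqP; have : (u - 1) * \sum_(i < N) u ^+ i == 0.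
  rewrite -subrX1 exprMn exprVn -!exprM ![(_ * N)%N]mulnC !exprM.
  by rewrite !(prim_expr_order z_prim) !expr1n divr1 subrr.
by rewrite mulf_eq0 subr_eq0 (negPf u1).
Qed.

(* Nontrivial characters of the cyclic group Z/N, transported along the tour s. *)
Definition fourier : 'M[C]_(n, N) :=
  \matrix_(j, a) ((sqrtC N%:R)^-1 * z ^- (j.+1 * (s^-1%g a))).

Lemma fourier_mul_conj j k a b : fourier j (s a) * (fourier k (s b))^* =
  N%:R^-1 * (z ^+ (k.+1 * b) / z ^+ (j.+1 * a)).
Proof.
rewrite !mxE !permK rmorphM /= !fmorphV /= rmorphXn /= conj_prim_root exprVn invrK.
rewrite mulrACA conj_Creal ?ger0_real ?sqrtC_ge0 ?ler0n // -invfM -expr2 sqrtCK.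
by rewrite [X in _ * X]mulrC.
Qed.

Lemma fourier_unitary : fourier \is unitarymx.
Proof.
have N0 : N%:R != 0 :> C by rewrite pnatr_eq0.
apply/unitarymxP/matrixP => j k; rewrite !mxE (reindex_inj (@perm_inj _ s)) /=.
under eq_bigr => a _ do rewrite trCmxE fourier_mul_conj
  !exprM -exprVn -exprMn.
rewrite -big_distrr sum_prim_root /= !modn_small ?ltnS ?ltn_ord //.
by rewrite mulKf // eqSS eq_sym.
Qed.

(** All [N] characters together would give the identity; the trivial one, absent from [fourier],
    accounts for the subtracted [N%:R^-1 *: Jmx]. *)
Lemma fourier_projection : fourier^t* *m fourier = Pperp C N.
Proof.
have N0 : N%:R != 0 :> C by rewrite pnatr_eq0.
apply/matrixP => a b; rewrite !mxE -[a](permKV s) -[b](permKV s).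
move: (s^-1%g a) (s^-1%g b) => {a b} x y; rewrite (inj_eq perm_inj).
under eq_bigr => j _ do rewrite trCmxE mulrC
  fourier_mul_conj ![(j.+1 * _)%N]mulnC !exprM -exprVn -exprMn.
rewrite -big_distrr /=.
have := sum_prim_root x y; rewrite big_ord_recl expr0 /= => /(canRL (addKr _))->.
rewrite !modn_small ?ltn_ord // mulrDr mulKf // big_ord_recl big_ord0 !mxE.
by rewrite addr0 !mulr1 mulrN1 addrC.
Qed.

(** The multipliers [1 - z ^+ j.+1] are eigenvalues of the identity minus the cyclic shift along the
    tour, so the weighted trace picks out entries of [B] between consecutive cities and on the
    diagonal. *)
Lemma sum_fourier_diag (B : 'M[C]_N) :
  \sum_(j < n) (1 - z ^+ j.+1) *
     (fourier *m (- compress B)^T *m fourier^t*) j j =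
  \sum_i (B (s i) (s (ordS i)) - B (s i) (s i)).
Proof.
have N0 : N%:R != 0 :> C by rewrite pnatr_eq0.
have [f [g BE]] := compress_entry B.
pose K x y := \sum_(j < n) (1 - z ^+ j.+1) * (fourier j (s x) * (fourier j (s y))^*).
have KE x y : K x y = (x == y)%:R - (x == ordS y)%:R.
  have -> : K x y = \sum_(j < N) (N%:R^-1 * (z ^+ y / z ^+ x) ^+ j
                       - N%:R^-1 * (z ^+ y.+1 / z ^+ x) ^+ j).
    (* The trivial character has multiplier [1 - z ^+ 0 = 0], so it can be added to complete the sum
       over all [N] characters. *)
    rewrite big_ord_recl !expr0 subrr add0r; apply: eq_bigr => j _.
    rewrite fourier_mul_conj ![(j.+1 * _)%N]mulnC !exprM -exprVn -exprMn.
    rewrite -mulrBr mulrCA mulrBl mul1r; congr (_ * (_ - _)).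
    by rewrite -exprMn mulrA -exprS.
  rewrite sumrB -!big_distrr /= !sum_prim_root !mulKf //.
  by rewrite !(modn_small (ltn_ord _)) eq_sym; congr (_ - _%:R); rewrite eq_sym.
transitivity (\sum_x \sum_y K x y * (- compress B) (s y) (s x)).
  under eq_bigr => j _.
    rewrite mxE (reindex_inj (@perm_inj _ s)) /=.
    under eq_bigr => y _.
      rewrite mxE (reindex_inj (@perm_inj _ s)) big_distrl /=.
      under eq_bigr => x _ do rewrite [_^T _ _]mxE trCmxE mulrAC.
      over.
    rewrite exchange_big big_distrr /=.
    under eq_bigr do rewrite big_distrr /=.
    over.
  rewrite exchange_big; apply: eq_bigr => x _; rewrite exchange_big.
  by apply: eq_bigr => y _; rewrite big_distrl; apply: eq_bigr => j _; rewrite !mulrA.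
rewrite exchange_big /=.
transitivity (\sum_y (compress B (s y) (s (ordS y)) - compress B (s y) (s y))).
  have pick v (h : 'I_N -> C) : \sum_x (x == v)%:R * h x = h v.
    rewrite (bigD1 v) //= eqxx mul1r big1 ?addr0 // => x /negPf->.
    by rewrite mul0r.
  apply: eq_bigr => y _; under eq_bigr do rewrite KE mxE mulrBl.
  by rewrite sumrB !pick opprK addrC.
(* The row terms [f] cancel within each summand; the column terms [g] cancel after reindexing by
   [ordS]. *)
transitivity (\sum_y (B (s y) (s (ordS y)) - B (s y) (s y)
                      + (g (s y) - g (s (ordS y))))).
  by apply: eq_bigr => y _; rewrite !BE; ring.
rewrite big_split /= [X in _ + X]sumrB [X in _ + (X - _)](reindex_inj (@ordS_inj _)).
by rewrite subrr addr0.
Qed.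

Lemma fourier_compress (B : 'M[C]_N) :
  fourier *m (compress B)^T *m fourier^t* *m fourier = fourier *m (compress B)^T.
Proof. by rewrite -mulmxA fourier_projection -mulmxA tr_compress compress_Pperp. Qed.

Lemma ones_perp_eq_fourier : (row_base (ones_perp C N) :=: fourier)%MS.
Proof.
apply: eqmx_trans (eq_row_base _) _; apply/eqmxP/andP; split.
  have /mul_Pperp_id <- : ones_perp C N *m ones C N = 0 by apply: mulmx_ker.
  by rewrite -fourier_projection mulmxA submxMl.
apply/sub_kermxP; rewrite -[fourier]mul1mx -(unitarymxP fourier_unitary).
by rewrite -(mulmxA fourier) fourier_projection -mulmxA Pperp_ones mulmx0.
Qed.

(** The rows of [fourier] are another basis of [ones_perp], stable under the transpose that
    [restrict_perp] uses, so the restriction can be computed in it. *)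
Lemma char_poly_restrict_perp (B : 'M[C]_N) :
  char_poly (restrict_perp (compress B)) =
  char_poly (fourier *m (compress B)^T *m fourier^t*).
Proof.
have free : row_free fourier.
  by rewrite /row_free mxrank_unitary ?fourier_unitary.
have stable : stablemx fourier (compress B)^T.
  by rewrite -fourier_compress submxMl.
rewrite /restrict_perp (char_poly_conjmx_eqmx _ free ones_perp_eq_fourier stable).
  by rewrite /conjmx -[in LHS]fourier_compress -(mulmxA _ fourier) mulmxVp ?mulmx1.
by rewrite row_base_free.
Qed.

(** The inner factors [fourier^t* *m fourier] are the projection, which the compression absorbs, so
    the commutation of [f] with its adjoint carries over. *)
Lemma fourier_normal (B : 'M[C]_N) : compress B \is normalmx ->
  fourier *m (compress B)^T *m fourier^t* \is normalmx.
Proof.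
move=> /trmx_normal/normalmxP; set f := _^T => nf; apply/normalmxP.
have Pf : Pperp C N *m f = f by rewrite /f tr_compress Pperp_compress.
have fP : f *m Pperp C N = f by rewrite /f tr_compress compress_Pperp.
rewrite trCmx_conj !mulmxA -(mulmxA _ (fourier^t*)) fourier_projection.
rewrite -(mulmxA fourier f) fP -(mulmxA _ (fourier^t*)) fourier_projection.
by rewrite -(mulmxA _ (Pperp C N)) Pf -!(mulmxA fourier) nf.
Qed.

Lemma fourier_hermitian (B : 'M[C]_N) : compress B \is hermsymmx ->
  fourier *m (compress B)^T *m fourier^t* \is hermsymmx.
Proof.
move=> /is_hermitianmxP; rewrite expr0 scale1r => hB.
apply/is_hermitianmxP; rewrite expr0 scale1r trCmx_conj {1}hB.
by rewrite map_trmx.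
Qed.

End Fourier.

(** * Primitive roots of unity in trigonometric form *)

Section Roots.
Variables (R : realType) (N : nat).
Hypothesis N_gt0 : (0 < N)%N.

Lemma expiD (x y : R) : expi (x + y) = expi x * expi y.
Proof. by rewrite /expi cosD sinD [sin x * _ + _]addrC. Qed.

Lemma expi_angle j : expi (angle R N j) = expi (angle R N 1) ^+ j.
Proof.
elim: j => [|j IHj]; first by rewrite /angle mulr0 mul0r /expi cos0 sin0.
rewrite exprS -IHj -expiD; congr expi.
by rewrite /angle -mulrDl -mulrDr -natrD.
Qed.

(** With [t] half the angle, [0 < t < pi] gives [sin t > 0], whereas [cos (2 t) = 1] would force
    [sin t = 0]. *)
Lemma expi_angle_neq1 j : (0 < j < N)%N -> expi (angle R N j) != 1.
Proof.
move=> /andP[j0 jN]; pose t : R := pi * (j%:R / N%:R).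
have angleE : angle R N j = t *+ 2 by rewrite -[t *+ 2]mulr_natl /angle /t !mulrA.
have t_sin : 0 < sin t.
  apply: sin_gt0_pi; rewrite mulr_gt0 ?divr_gt0 ?pi_gt0 ?ltr0n //=.
  by rewrite gtr_pMr ?pi_gt0 // ltr_pdivrMr ?ltr0n // mul1r ltr_nat.
apply: contraTneq t_sin => -[]; rewrite angleE cos_mulr2n cos2sin2 => cos1 _.
have : sin t ^+ 2 = 0 by lra.
by move/eqP; rewrite expf_eq0 /= => /eqP->; rewrite ltxx.
Qed.

Lemma expi_angle_prim : N.-primitive_root (expi (angle R N 1)).
Proof.
apply/andP; split=> //; apply/forallP => i; rewrite unity_rootE -expi_angle.
have [->|iN] := eqVneq i.+1 N.
  rewrite /angle mulfK ?pnatr_eq0 -?lt0n // mulr_natl /expi cos2pi sin2pi.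
  by rewrite eqxx.
apply/eqP/negbTE/expi_angle_neq1; rewrite /= ltn_neqAle iN.
exact: ltn_ord.
Qed.

End Roots.

(** * The lower bound for a single tour *)

Section Bound.
Variable R : realType.
Local Notation C := R[i].

Lemma ReD : {morph @complex.Re R : x y / x + y >-> x + y}.
Proof. by case=> ? ? []. Qed.

Lemma Re_sum (I : finType) (F : I -> C) :
  complex.Re (\sum_i F i) = \sum_i complex.Re (F i).
Proof. exact: (big_morph _ ReD). Qed.

Lemma Re_mul_real (x : C) (r : R) : complex.Re (x * r%:C%C) = complex.Re x * r.
Proof. by case: x => a b /=; rewrite mulr0 subr0. Qed.

(** Shifts indices from [0 .. n - 1] to the range [1 .. n] read by [perp_eigenvalues], with default
    0 past the end. *)
Definition labeling n (d : 'I_n -> C) (j : nat) : C := oapp d 0 (insub j.-1).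

Lemma labelingE n (d : 'I_n -> C) (i : 'I_n) : labeling d i.+1 = d i.
Proof. by rewrite /labeling /= valK. Qed.

Lemma char_poly_diag n (d : 'rV[C]_n) :
  char_poly (diag_mx d) = \prod_i ('X - (d 0 i)%:P).
Proof.
rewrite char_poly_trig ?diag_mx_is_trig //.
by apply: eq_bigr => i _; rewrite mxE eqxx.
Qed.

Lemma char_poly_normal n (A : 'M[C]_n) : A \is normalmx ->
  char_poly A = \prod_i ('X - (spectral_diag A 0 i)%:P).
Proof.
move=> /orthomx_spectralP; set P := spectralmx A; set d := spectral_diag A => AE.
rewrite -char_poly_diag; apply: (@char_poly_similar _ _ (invmx P)).
  by rewrite unitmx_inv spectral_unit.
by rewrite {1}AE mulmxK ?spectral_unit.
Qed.

(** The entries are the squared moduli of [U], taken as real parts to land in [R]; row sums come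
    from [U^t* *m U = 1] and column sums from [U *m U^t* = 1]. *)
Lemma unitary_doubly_stochastic n (U : 'M[C]_n) : U \is unitarymx ->
  doubly_stochastic (\matrix_(j, k) complex.Re ((U k j)^* * U k j)).
Proof.
move=> Uu; have Uu' : U^t* *m U = 1%:M.
  by apply: mulmx1C; apply/unitarymxP.
split=> [i j|j|k].
- by rewrite mxE; have := mul_conjC_ge0 (U j i); rewrite mulrC lecE => /andP[].
- under eq_bigr do rewrite mxE; rewrite -Re_sum.
  move/matrixP/(_ j j): Uu'; rewrite !mxE eqxx mulr1n => Ujj.
  rewrite -[RHS]/(complex.Re (1 : C)) -[in RHS]Ujj; congr complex.Re.
  by apply: eq_bigr => k _; rewrite trCmxE.
- under eq_bigr do rewrite mxE; rewrite -Re_sum.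
  move/unitarymxP/matrixP/(_ k k): Uu; rewrite !mxE eqxx mulr1n => Ukk.
  rewrite -[RHS]/(complex.Re (1 : C)) -[in RHS]Ukk; congr complex.Re.
  by apply: eq_bigr => j _; rewrite trCmxE mulrC.
Qed.

(** Diagonalizing gives [A j j] as the sum over [k] of [|U k j|^2 d k], so the right-hand side is an
    assignment cost averaged over a doubly stochastic matrix. *)
Lemma normal_trace_bound n (A : 'M[C]_n) (c : 'I_n -> C) : A \is normalmx ->
  exists s : 'S_n, \sum_j complex.Re (c j * spectral_diag A 0 (s j)) <=
                   complex.Re (\sum_j c j * A j j).
Proof.
move=> /orthomx_spectralP; set U := spectralmx A; set d := spectral_diag A => AE.
have Uu : U \is unitarymx by apply: spectral_unitarymx.
have [s les] := assignment (\matrix_(j, k) complex.Re (c j * d 0 k))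
  (unitary_doubly_stochastic Uu).
exists s; under eq_bigr do rewrite -(mxE matrix_key (fun j k => complex.Re (c j * d 0 k))).
apply: le_trans les _; rewrite Re_sum le_eqVlt; apply/orP; left; apply/eqP.
apply: eq_bigr => j _; rewrite AE (invmx_unitary Uu) mxE big_distrr /= Re_sum.
apply: eq_bigr => k _; rewrite 2![in LHS]mxE mul_mx_diag mxE trCmxE.
have -> : c j * ((U k j)^* * d 0 k * U k j) = c j * d 0 k * ((U k j)^* * U k j).
  by ring.
(* The weight is real, so it can be pulled out of the real part. *)
have S_ge0 : 0 <= (U k j)^* * U k j by rewrite mulrC mul_conjC_ge0.
rewrite -[X in _ = complex.Re (_ * X)]RRe_real ?ger0_real //.
by rewrite Re_mul_real mulrC.
Qed.

(** The factor [k] covers both uses: 1 for the normal and Hermitian cases, the imaginary unit for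
    the anti-Hermitian part. The labeling [w] depends on the tour [s]. *)
Lemma tour_bound n (B : 'M[C]_n.+1) (s : 'S_n.+1) (k : C) :
    compress B \is normalmx ->
  exists2 w, perp_eigenvalues (- compress B) w
    & \sum_(1 <= j < n.+1) complex.Re (k * (1 - expi (angle R n.+1 j)) * w j) <=
      complex.Re (k * \sum_i (B (s i) (s (ordS i)) - B (s i) (s i))).
Proof.
move=> nB; pose z := expi (angle R n.+1 1).
have z_prim : n.+1.-primitive_root z by apply: expi_angle_prim.
pose Y := fourier z s *m (- compress B)^T *m (fourier z s)^t*.
have nY : Y \is normalmx.
  rewrite /Y compressN; apply: (fourier_normal s z_prim).
  by rewrite -compressN; exact: normalmxN.
have [p lep] := normal_trace_bound (fun j : 'I_n => k * (1 - z ^+ j.+1)) nY.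
exists (labeling (fun i => spectral_diag Y 0 (p i))).
  rewrite /perp_eigenvalues big_add1 big_mkord compressN.
  rewrite (char_poly_restrict_perp s z_prim) -compressN -/Y char_poly_normal //.
  rewrite (reindex_inj (@perm_inj _ p)); apply: eq_bigr => i _.
  by rewrite labelingE.
rewrite big_add1 big_mkord -(sum_fourier_diag s z_prim) big_distrr /=.
under eq_bigr => j _ do rewrite labelingE expi_angle -/z.
by under [in leRHS]eq_bigr => j _ do rewrite mulrA.
Qed.

(** Each [w j] is a root of the characteristic polynomial of a Hermitian matrix, written in the
    Fourier basis along the identity tour, hence one of its real spectral values. *)
Lemma hermitian_perp_eigenvalues_real n (B : 'M[C]_n.+1) w j :
    B \is hermsymmx -> perp_eigenvalues (- compress B) w ->
  (1 <= j < n.+1)%N -> complex.Im (w j) = 0.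
Proof.
have z_prim := expi_angle_prim R (ltn0Sn n).
move=> hB; rewrite /perp_eigenvalues compressN (char_poly_restrict_perp 1%g z_prim).
set Y := _ *m _.
have hY : Y \is hermsymmx by apply/fourier_hermitian/compress_hermitian/hermsymmxN.
rewrite char_poly_normal ?hermitian_normalmx // => wE jn.
have : root (\prod_(1 <= j < n.+1) ('X - (w j)%:P)) (w j).
  by rewrite (big_rem j) ?mem_index_iota //= rootM root_XsubC eqxx.
rewrite -wE -(big_map _ predT (fun x => 'X - x%:P)) root_prod_XsubC.
move=> /mapP[i _ ->].
have /mxOverP/(_ 0 i) := hermitian_spectral_diag_real hY.
by move/RIm_real/eqP; rewrite eq_complex /= => /andP[/eqP].
Qed.

End Bound.

(** * Hermitian splitting and the bounds on the optimal tour *)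

Local Open Scope complex_scope.

Lemma conjC_real_complex (R : realType) (x : R) : x%:C^*%R = x%:C.
Proof. by apply: conj_Creal; rewrite complex_real. Qed.

Lemma hermitian_part (R : realType) n (D : 'M[R]_n) :
  2^-1 *: (toC D + (toC D)^T) \is hermsymmx.
Proof.
apply/is_hermitianmxP; rewrite expr0 scale1r; apply/matrixP => i j; rewrite !mxE.
rewrite rmorphM fmorphV rmorph_nat rmorphD /= !conjC_real_complex.
by rewrite addrC.
Qed.

(** Conjugation negates [2 * 'i] and transposition negates the difference, so the two signs
    cancel. *)
Lemma antihermitian_part (R : realType) n (D : 'M[R]_n) :
  (2 * 'i%C)^-1 *: (toC D - (toC D)^T) \is hermsymmx.
Proof.
apply/is_hermitianmxP; rewrite expr0 scale1r; apply/matrixP => i j; rewrite !mxE.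
rewrite rmorphM fmorphV rmorphM rmorph_nat rmorphB /= !conjC_real_complex.
by rewrite complexiE conjCi mulrN invrN mulNr -mulrN opprB.
Qed.

Theorem theorem2 (R : realType) (N : nat) (D : 'M[R]_N) (hN : (2 <= N)%N)
  (hD : forall i : 'I_N, D i i = 0) :
  (compress (toC D) \is normalmx ->
   forall w : nat -> R[i],
     minimizing_labeling (- compress (toC D)) (normal_sum N) w ->
     Lmin D >= \sum_(1 <= j < N) complex.Re ((1 - expi (angle R N j)) * w j)
     /\ \sum_(1 <= j < N) complex.Re ((1 - expi (angle R N j)) * w j) =
        \sum_(1 <= j < N) ((1 - cos (angle R N j)) * complex.Re (w j)
                           + sin (angle R N j) * complex.Im (w j)))
  /\
  (forall muH muAH : nat -> R[i],
     minimizing_labeling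
       (- compress (2^-1 *: (toC D + (toC D)^T))) (cos_sum N) muH ->
     minimizing_labeling
       (- compress ((2 * 'i%C)^-1 *: (toC D - (toC D)^T))) (sin_sum N) muAH ->
     [/\ forall j : nat, (1 <= j < N)%N -> complex.Im (muH j) = 0,
         forall j : nat, (1 <= j < N)%N -> complex.Im (muAH j) = 0
       & Lmin D >=
         \sum_(1 <= j < N) (1 - cos (angle R N j)) * complex.Re (muH j)
         + \sum_(1 <= j < N) sin (angle R N j) * complex.Re (muAH j)]).
Proof.
case: N D hN hD => [|n] D // _ D0.
have toursE s (B : 'M[R[i]]_n.+1) : (forall i, B i i = 0) ->
    \sum_i (B (s i) (s (ordS i)) - B (s i) (s i)) = \sum_i B (s i) (s (ordS i)).
  by move=> B0; apply: eq_bigr => i _; rewrite B0 subr0.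
have Lmin_ge x : (forall s, x <= tour_length D s) -> x <= Lmin D.
  by move=> lex; apply: le_bigmin.
split=> [nD w [wD w_min]|muH muAH [muH_eig muH_min] [muAH_eig muAH_min]].
  split; last first.
    apply: eq_bigr => j _; case: (w j) => a b /=.
    by rewrite sub0r mulNr opprK.
  (* The labeling [w'] found for [s] varies with the tour; minimality of [w] replaces it by one
     labeling valid for all tours. *)
  apply: Lmin_ge => s; have [w' w'D lew'] := tour_bound s 1 nD.
  apply: le_trans (w_min _ w'D) _; rewrite /normal_sum.
  under eq_bigr do rewrite -[1 - _]mul1r.
  apply: le_trans lew' _; rewrite mul1r toursE => [|i]; last by rewrite mxE D0.
  by rewrite Re_sum; under eq_bigr do rewrite mxE.
set H := _ *: (_ + _) in muH_eig muH_min.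
set K := _ *: (_ - _) in muAH_eig muAH_min.
have H_herm : H \is hermsymmx by apply: hermitian_part.
have K_herm : K \is hermsymmx by apply: antihermitian_part.
have H0 i : H i i = 0 by rewrite !mxE D0 addr0 mulr0.
have K0 i : K i i = 0 by rewrite !mxE D0 subrr mulr0.
have cosE w : perp_eigenvalues (- compress H) w -> cos_sum n.+1 w =
    \sum_(1 <= j < n.+1) complex.Re (1 * (1 - expi (angle R n.+1 j)) * w j).
  move=> wH; apply: eq_big_nat => j jn.
  have := hermitian_perp_eigenvalues_real H_herm wH jn.
  by case: (w j) => a b /= ->; ring.
(* Since ['i (1 - e^(i t)) = sin t + 'i (1 - cos t)], a real [w j] leaves only the sine term in the
   real part. *)
have sinE w : perp_eigenvalues (- compress K) w -> sin_sum n.+1 w =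
    \sum_(1 <= j < n.+1) complex.Re ('i%C * (1 - expi (angle R n.+1 j)) * w j).
  move=> wK; apply: eq_big_nat => j jn.
  have := hermitian_perp_eigenvalues_real K_herm wK jn.
  by case: (w j) => a b /= ->; ring.
split=> [j|j|].
- exact: hermitian_perp_eigenvalues_real H_herm muH_eig.
- exact: hermitian_perp_eigenvalues_real K_herm muAH_eig.
apply: Lmin_ge => s.
(* The two parts get independent labelings, each compared with its own minimizer. *)
have [wH wH_eig] := tour_bound s 1 (hermitian_normalmx (compress_hermitian H_herm)).
have [wK wK_eig] := tour_bound s 'i%C (hermitian_normalmx (compress_hermitian K_herm)).
rewrite -cosE // -sinE // !toursE // => leK leH.
(* Entrywise [D = H + 'i K], and [D] is real, so the tour length equals its real part. *)
have -> : tour_length D s = complex.Re (1 * \sum_i H (s i) (s (ordS i)))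
                          + complex.Re ('i%C * \sum_i K (s i) (s (ordS i))).
  rewrite !big_distrr !Re_sum -big_split; apply: eq_bigr => i _ /=.
  rewrite -ReD mul1r -[LHS]/(complex.Re (D (s i) (s (ordS i)))%:C).
  congr complex.Re; rewrite !mxE.
  have i0 : 'i%C != 0 :> R[i] by rewrite complexiE neq0Ci.
  by field.
by apply: lerD; [apply: le_trans leH; apply: muH_min
  | apply: le_trans leK; apply: muAH_min].
Qed.
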